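(* Let $h_n'$ be the number of simple normalized set systems of weight $n$, let $h_n''$ be the number of all normalized set systems of weight $n$ (repeated edges allowed), and let $b_n$ be the $n$-th Bell number. As $n\to\infty$, $$h_n'=\left(\frac{1}{\log 2}+o(1)\right)^n b_n \qquad\text{and}\qquad h_n''=\left(\frac{1}{\log 2}+o(1)\right)^n b_n ,$$ where $1/\log 2=1.44269\dots$.
   Context: $\mathbf{N}=\{1,2,\dots\}$ and $[m]=\{1,2,\dots,m\}$. A set system $H$ is a finite multiset of nonempty finite subsets of $\mathbf{N}$, called edges (so an edge may occur with multiplicity greater than one). $H$ is simple if it has no repeated edges. The vertex set is $V(H)=\bigcup_{E\in H}E$, and $H$ is normalized if $V(H)=[m]$ for some $m\in\mathbf{N}$. The weight of $H$ is $w(H)=\sum_{E\in H}|E|$, with edges counted with multiplicity. The Bell number $b_n$ is the number of set partitions of $[n]$. $\log$ is the natural logarithm. The notation $a_n=(c+o(1))^n b_n$ means that $(a_n/b_n)^{1/n}\to c$ as $n\to\infty$. *)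

(* Defs.v *)
From mathcomp Require Import all_boot all_order all_algebra.
From mathcomp Require Import finmap multiset.
From mathcomp Require Import all_classical all_reals all_analysis.

Set Implicit Arguments.
Unset Strict Implicit.
Unset Printing Implicit Defensive.

Import Order.TTheory GRing.Theory Num.Theory.
Import numFieldNormedType.Exports.

Local Open Scope classical_set_scope.
Local Open Scope fset_scope.
Local Open Scope mset_scope.
Local Open Scope nat_scope.

(* Vertices are the positive integers, so edges are nonempty finite sets of
   naturals not containing 0. *)
Definition set_system (H : {mset {fset nat}}) : Prop :=
  forall E, E \in H -> E != fset0 /\ 0 \notin E.

Definition simple (H : {mset {fset nat}}) : Prop :=
  forall E, H E <= 1.

Definition vertices (H : {mset {fset nat}}) : {fset nat} :=
  \bigcup_(E <- H) E.

Definition normalized (H : {mset {fset nat}}) : Prop :=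
  exists2 m, 0 < m & vertices H = [fset i in iota 1 m].

(* The coercion of a multiset to a sequence repeats each element according to
   its multiplicity, so edges are counted with multiplicity here. *)
Definition weight (H : {mset {fset nat}}) : nat :=
  \sum_(E <- H) #|` E|.

Definition normalized_systems (n : nat) : set {mset {fset nat}} :=
  [set H | [/\ set_system H, normalized H & weight H = n]].

Definition simple_normalized_systems (n : nat) : set {mset {fset nat}} :=
  [set H | normalized_systems n H /\ simple H].

(* [fset_set] sends an infinite set to [fset0]. The sets below are finite: a
   normalized system of weight n has at most n edges, all inside [n]. *)
Definition num_simple_normalized (n : nat) : nat :=
  #|` fset_set (simple_normalized_systems n)|.

Definition num_normalized (n : nat) : nat :=
  #|` fset_set (normalized_systems n)|.

Definition bell (n : nat) : nat :=
  #|[set P : {set {set 'I_n}} | finset.partition P [set: 'I_n]]%SET|.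

Local Open Scope ring_scope.

(* a_n = (c + o(1))^n b_n *)
Definition root_asymptotic (R : realType) (c : R) (a b : nat -> nat) : Prop :=
  ((a n)%:R / (b n)%:R : R) `^ (n%:R^-1) @[n --> \oo] --> c.

(* Main.v *)
Require Import Defs.
From mathcomp Require Import all_boot all_order all_algebra.
From mathcomp Require Import finmap multiset.
From mathcomp Require Import all_classical all_reals all_analysis.
From mathcomp Require Import zify ring lra.

(** Write h'(n), h''(n) for the numbers of simple and of all normalized systems,
    D(n) for the sum of N^n / N! over N <= n, and l = log 2.

    Counting maps from [n] to [N] by their kernel gives N^n as the sum of the
    falling factorials N(N-1)...(N-|P|+1) over the partitions P of [n]. Since the
    sum over N of such a falling factorial divided by N! is at most e, and at
    least 1 once N reaches |P|, b(n) and D(n) agree up to the factor e.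

    A normalized system whose edges are put in N numbered rows (some of them
    empty) is a 0-1 matrix with nonzero columns. Read by columns, there are A(N, n)
    matrices of weight n, where A(N, n) is the sum of 'C(N, d) * A(N, n - d) over
    d >= 1; comparing with the recursion solved by l^-n, A(N, n) is at most
    N^n l^-n and A(M + k, n) is at least of order M^n x^-n when x > l and k is
    large. A simple system with e edges has exactly e! orderings, so
    h'(n) <= l^-n D(n). Any system with e edges fits in N rows in at most
    N(N-1)...(N-e+1) ways, and averaging over N bounds h''(n) below by x^-n D(n)
    up to a polynomial factor.

    To compare h' and h'', record a system by its support and its surplus
    multiplicities: for every q, h''(n) <= (q/(q-1))^n * sum_t q^t h'(n - t).
    Bound h'(n - t) by the geometric mean of h'(n) and l^-(n-t) D(n - t), where
    D(n - t) = O(K^-t D(n)) for every K. With K = (2q)^2 this gives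
    h''(n)^2 <= C (q/(q-1))^(2n) l^-n h'(n) D(n), which transfers the lower bound
    from h'' to h' and the upper bound from h' to h''. *)

Set Implicit Arguments.
Unset Strict Implicit.
Unset Printing Implicit Defensive.
Import Order.TTheory GRing.Theory Num.Theory.
Import numFieldNormedType.Exports.
Local Open Scope nat_scope.

(** * Enumerations by sequences *)

Lemma leq_size_in_inj (T U : eqType) (f : T -> U) (s : seq T) (t : seq U) :
  uniq s -> {in s &, injective f} -> {in s, forall x, f x \in t} ->
  size s <= size t.
Proof.
move=> us fi st; rewrite -(size_map f); apply: uniq_leq_size.
  by rewrite map_inj_in_uniq.
by move=> _ /mapP[x xs ->]; exact: st.
Qed.

Lemma leq_size_sum_fibers (T U : eqType) (f : T -> U) (s : seq T) (t : seq U)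
    (c : U -> nat) :
  {in s, forall x, f x \in t} ->
  {in t, forall y, count (fun x => f x == y) s <= c y} ->
  size s <= \sum_(y <- t) c y.
Proof.
move=> st cP; apply: leq_trans (_ : \sum_(y <- t) count (fun x => f x == y) s <= _).
  rewrite -sum1_size.
  under [X in _ <= X]eq_bigr do rewrite -sum1_count big_mkcond.
  rewrite exchange_big /= big_seq_cond [X in _ <= X]big_seq_cond.
  apply: leq_sum => x /andP[xs _]; rewrite (big_rem (f x)) ?st //=.
  by rewrite eqxx leq_addr.
by rewrite big_seq_cond [X in _ <= X]big_seq_cond; apply: leq_sum => y /andP[yt _]; exact: cP.
Qed.

Lemma size_flatten_map (T U : Type) (f : T -> seq U) (s : seq T) :
  size (flatten [seq f x | x <- s]) = \sum_(x <- s) size (f x).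
Proof. by rewrite size_flatten /shape -map_comp sumnE big_map. Qed.

(** * Arrangements of a multiset in numbered positions *)

Section Placements.
Variables (T : eqType) (x0 : T).

(** The ways to spread the members of [l] over [N] positions, with [x0] as the filler of free
    positions. Repeated members of [l] produce repeated entries, so the length of this list is only
    an upper bound for the number of arrangements. *)
Fixpoint placements N (l : seq T) : seq (seq T) :=
  if N is N'.+1 then
    map (cons x0) (placements N' l) ++
      flatten [seq map (cons x) (placements N' (rem x l)) | x <- l]
  else if l is [::] then [:: [::]] else [::].

Lemma mem_placements N (l s : seq T) : size s = N ->
  perm_eq [seq x <- s | x != x0] l -> s \in placements N l.
Proof.
elim: N l s => [|N IH] l [|x s] //=.
  by move=> _ /perm_size; case: l.
move=> [sN]; rewrite mem_cat; case: eqP => [->|/eqP xx0] /= sl.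
  by rewrite map_f // IH.
apply/orP; right; apply/flattenP => /=.
have xl : x \in l by rewrite -(perm_mem sl) inE eqxx.
exists (map (cons x) (placements N (rem x l))).
  by apply/mapP; exists x.
apply: map_f; apply: IH => //.
by have := perm_trans sl (perm_to_rem xl); rewrite perm_cons.
Qed.

Lemma size_placements N (l : seq T) : size (placements N l) <= N ^_ (size l).
Proof.
elim: N l => [|N IH] l /=; first by case: l.
rewrite size_cat size_map size_flatten_map.
(* The falling factorial obeys the recursion of [placements]: the first position is either free or
   takes one of the members of [l]. *)
have -> : N.+1 ^_ (size l) = N ^_ (size l) + \sum_(x <- l) N ^_ (size l).-1.
  rewrite big_const_seq count_predT iter_addn_0.
  case: (size l) => [|m]; first by rewrite !ffactn0 muln0 addn0.
  rewrite ffactSS /= ffactnSr addnC.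
  have [mN|Nm] := leqP m N; last by rewrite ffact_small // !muln0 mul0n.
  nia.
apply: leq_add; first exact: IH.
rewrite big_seq_cond [X in _ <= X]big_seq_cond; apply: leq_sum => x /andP[xl _].
by rewrite size_map -(size_rem xl) IH.
Qed.

End Placements.

Fixpoint bounded_seqs e t : seq (seq nat) :=
  if e is e'.+1 then
    flatten [seq map (cons j) (bounded_seqs e' (t - j)) | j <- iota 0 t.+1]
  else [:: [::]].

Lemma mem_bounded_seqs e t s : size s = e -> sumn s <= t -> s \in bounded_seqs e t.
Proof.
elim: e t s => [|e IH] t [|j s] // [se] jst; apply/flattenP.
exists (map (cons j) (bounded_seqs e (t - j))).
  apply/mapP; exists j => //; rewrite mem_iota /=.
  exact: leq_trans (leq_addr _ _) jst.
by apply: map_f; apply: IH => //; rewrite leq_subRL ?(leq_trans (leq_addr _ _) jst).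
Qed.

(* Weighting a sequence s by q ^ - sumn s, all sequences of length e together
   have weight (q / (q - 1)) ^ e. *)
Lemma size_bounded_seqs e t q : 0 < q ->
  size (bounded_seqs e t) * q.-1 ^ e <= q ^ (t + e).
Proof.
move=> q0; elim: e t => [|e IH] t; first by rewrite mul1n addn0 expn_gt0 q0.
rewrite (_ : bounded_seqs e.+1 t = flatten
  [seq map (cons j) (bounded_seqs e (t - j)) | j <- iota 0 t.+1]) //.
rewrite size_flatten_map big_distrl.
apply: (@leq_trans (\sum_(0 <= j < t.+1) q.-1 * q ^ (t - j + e))).
  rewrite big_seq_cond [X in _ <= X]big_seq_cond; apply: leq_sum => j _.
  rewrite size_map expnS.
  by apply: leq_trans (leq_mul (leqnn q.-1) (IH (t - j))); rewrite [X in X <= _]mulnCA.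
rewrite -big_distrr /= addnS big_nat_rev /= add0n.
rewrite (eq_big_nat _ _ (F2 := fun j => q ^ e * q ^ j)); last first.
  by move=> j /andP[_ jt]; rewrite -expnD addnC; congr (q ^ (_ + _)); lia.
rewrite -big_distrr /= mulnCA big_mkord -predn_exp -addSn addnC expnD.
by rewrite leq_mul2l leq_pred orbT.
Qed.

(** * 0-1 matrices with nonzero columns, read by columns *)

Section Columns.
Variable N : nat.
Implicit Types (c : seq {set 'I_N}).

(** The matrices with [N] rows and weight [n], a column being the set of its rows with entry 1. The
    argument [f] is fuel, because [n - #|C|] is not a structural subterm; any [f >= n] gives the
    full list, whose length is A(N, n). *)
Fixpoint col_seqs f n : seq (seq {set 'I_N}) :=
  if n is n'.+1 then
    if f is f'.+1 then
      flatten (map (fun C : {set 'I_N} => map (cons C) (col_seqs f' (n - #|C|)))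
        (seq.filter (fun C : {set 'I_N} => 0 < #|C| <= n) (enum {: {set 'I_N}})))
    else [::]
  else [:: [::]].

Lemma mem_col_seqs f n c : n <= f ->
  (c \in col_seqs f n) =
    all (fun C : {set 'I_N} => 0 < #|C|) c && (\sum_(C <- c) #|pred_of_set C| == n).
Proof.
elim: f n c => [|f IH] [|n] c // nf.
- rewrite /= inE; case: c => [|C c] //=; first by rewrite big_nil.
  by rewrite big_cons addn_eq0 lt0n; case: (#|C| == 0); rewrite /= ?andbF.
- rewrite /= inE; case: c => [|C c] //=; first by rewrite big_nil.
  by rewrite big_cons addn_eq0 lt0n; case: (#|C| == 0); rewrite /= ?andbF.
rewrite [col_seqs _ _]/=; apply/flattenP/andP => /= [[_ /mapP[C + ->] /mapP[c']]|].
  rewrite mem_filter => /andP[/andP[C0 Cn] _] c'P ->; move: c'P.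
  rewrite IH; last by lia.
  by move=> /andP[c'0 /eqP c'n] /=; rewrite C0 c'0 big_cons c'n subnKC.
case: c => [|C c]; first by rewrite big_nil => -[].
rewrite big_cons /= => -[/andP[C0 c0] /eqP Cc].
exists [seq C :: i | i <- col_seqs f (n.+1 - #|C|)].
  by apply/mapP; exists C => //; rewrite mem_filter C0 mem_enum /= andbT; lia.
apply: map_f; rewrite IH; last first.
  by rewrite leq_subLR (leq_trans nf) // -add1n leq_add2r.
by rewrite c0 /= -Cc addKn.
Qed.

Lemma col_seqs_uniq f n : uniq (col_seqs f n).
Proof.
elim: f n => [|f IH] [|n] //; rewrite [col_seqs _ _]/=.
apply: allpairs_uniq_dep => [|C _|].
- by rewrite filter_uniq // enum_uniq.
- exact: IH.
- by move=> [C c] [C' c'] _ _ /= [-> ->].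
Qed.

Lemma size_col_seqsS f n :
  size (col_seqs f.+1 n.+1) = \sum_(d < n.+1) 'C(N, d.+1) * size (col_seqs f (n - d)).
Proof.
rewrite [col_seqs _ _]/= size_flatten_map big_filter big_enum_cond /=.
(* The first column is classified by its size minus one; [inord] is exact here since the filter
   keeps sizes from 1 to [n.+1]. *)
pose h (C : {set 'I_N}) : 'I_n.+1 := inord #|C|.-1.
rewrite (partition_big h xpredT) //=; apply: eq_bigr => d _.
rewrite (eq_bigl (fun C : {set 'I_N} => #|C| == d.+1)); last first.
  move=> C; apply/idP/idP => [/andP[/andP[C0 Cn] /eqP hC]|/eqP Cd].
    have := congr1 val hC; rewrite /h /= inordK; lia.
  by rewrite Cd /= ltn_ord; apply/eqP/val_inj; rewrite /h Cd /= inordK ?ltn_ord.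
rewrite (eq_bigr (fun=> size (col_seqs f (n - d)))); last first.
  by move=> C /eqP ->; rewrite size_map subSS.
rewrite sum_nat_const; congr (_ * _).
by rewrite -[in RHS](card_ord N) -card_draws; apply: eq_card => C; rewrite !inE.
Qed.

End Columns.

(** * Maps with a given kernel *)

Section Kernels.
Variables (T : finType) (N : nat).

(** A map with kernel [P] is constant on blocks and separates them, so it amounts to an injection
    from the blocks of [P] into ['I_N]. *)
Lemma card_kernel (P : {set {set T}}) : finset.partition P [set: T]%SET ->
  #|[set f : {ffun T -> 'I_N} | finset.preim_partition f [set: T]%SET == P]| = N ^_ #|P|.
Proof.
move=> PP; have covP : finset.cover P = [set: T]%SET by have /and3P[/eqP] := PP.
have tiP : finset.trivIset P by have /and3P[] := PP.
have P0 : finset.set0 \notin P by have /and3P[] := PP.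
have pb x : finset.pblock P x \in P by rewrite pblock_mem // covP inE.
pose blk x : {B | B \in P} := exist _ (finset.pblock P x) (pb x).
have -> : N ^_ #|P| = #|[set h : {ffun {B | B \in P} -> 'I_N} | injectiveb h]%SET|.
  by rewrite card_inj_ffuns card_ord card_sig; congr (_ ^_ _); apply: eq_card.
pose F (h : {ffun {B | B \in P} -> 'I_N}) := [ffun x => h (blk x)].
have blkS (B : {B | B \in P}) : exists x, blk x == B.
  case: B => B PB; have /finset.set0Pn[x xB] : B != finset.set0 by apply: contraNneq P0 => <-.
  by exists x; apply/eqP/val_inj; rewrite /= (def_pblock tiP PB xB).
have Finj : injective F.
  move=> h1 h2 /ffunP Fh; apply/ffunP => B; have [x /eqP <-] := blkS B.
  by have := Fh x; rewrite !ffunE.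
have eqker (f : {ffun T -> 'I_N}) : reflect (forall x y, (f x == f y) = (blk x == blk y))
    (finset.preim_partition f [set: T]%SET == P).
  apply: (iffP eqP) => [fP x y|fP].
    have eqf : {in [set: T]%SET & &, equivalence_rel (fun x y => f x == f y)}.
      by move=> ? ? ? _ _ _; split=> // /eqP->.
    rewrite -(pblock_equivalence_partition eqf (finset.in_setT x) (finset.in_setT y)).
    rewrite -/(finset.preim_partition f [set: T]%SET) fP -eq_pblock ?covP ?inE //.
  rewrite -[RHS](preim_partition_pblock PP); apply: eq_imset => x.
  by apply/setP => y; rewrite !inE fP.
rewrite -(card_imset _ Finj); apply: eq_card => f; rewrite inE.
apply/eqker/imsetP => [fP|[h]].
  pose rep (B : {B | B \in P}) := xchoose (blkS B).
  have blkK B : blk (rep B) = B := eqP (xchooseP (blkS B)).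
  exists [ffun B => f (rep B)].
    rewrite inE; apply/injectiveP => B1 B2; rewrite !ffunE => /eqP.
    by rewrite fP !blkK => /eqP.
  by apply/ffunP => x; rewrite !ffunE; apply/eqP; rewrite fP blkK.
rewrite inE => /injectiveP hi -> x y; rewrite !ffunE; exact: inj_eq.
Qed.

Lemma sum_ffact_partition :
  \sum_(P : {set {set T}} | finset.partition P [set: T]%SET) N ^_ #|P| = N ^ #|T|.
Proof.
rewrite -[N in RHS]card_ord -card_ffun -sum1_card.
rewrite (partition_big (fun f : {ffun T -> 'I_N} => finset.preim_partition f [set: T]%SET)
  (fun P : {set {set T}} => finset.partition P [set: T]%SET)) /=; last first.
  by move=> f _; exact: preim_partitionP.
by apply: eq_bigr => P PP; rewrite -card_kernel // -sum1_card; apply: eq_bigl => f; rewrite inE.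
Qed.

Lemma card_partition_leq (P : {set {set T}}) : finset.partition P [set: T]%SET -> #|P| <= #|T|.
Proof.
move=> PP; rewrite -finset.cardsT (card_partition PP) -sum1_card; apply: leq_sum => B PB.
by rewrite card_gt0; apply: contraTneq PB => ->; have /and3P[] := PP.
Qed.

End Kernels.

(** * Incidence matrices of set systems *)

Local Open Scope fset_scope.
Local Open Scope mset_scope.
Local Open Scope nat_scope.

Implicit Types (H : {mset {fset nat}}) (E : {fset nat}) (s : seq {fset nat}).

(** Row sequences of matrices of weight [n]: unlike in a normalized system, empty rows are allowed,
    order matters, and [m] may be 0. *)
Definition row_seq (n : nat) s : Prop :=
  [/\ {in s, forall E, 0 \notin E},
      exists m, \bigcup_(E <- s) E = [fset i in iota 1 m]
    & \sum_(E <- s) #|` E| = n].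

Section Rows.
Variable N : nat.
Implicit Types (c : seq {set 'I_N}) (i : 'I_N).

(** Vertices start at 1 but positions in [c] start at 0, so vertex [k] belongs to column [k.-1]. *)
Definition row c i : {fset nat} :=
  [fset k in [seq k <- iota 1 (size c) | i \in nth finset.set0 c k.-1]].

Definition rows c : seq {fset nat} := [seq row c i | i <- enum 'I_N].

Lemma in_row c i k : (k \in row c i) = (0 < k <= size c) && (i \in nth finset.set0 c k.-1).
Proof. by rewrite inE /= mem_filter mem_iota add1n ltnS andbC. Qed.

Lemma size_rows c : size (rows c) = N.
Proof. by rewrite size_map size_enum_ord. Qed.

Lemma card_row c i : #|` row c i| = count (fun C : {set 'I_N} => i \in C) c.
Proof.
rewrite card_fseq undup_id ?filter_uniq ?iota_uniq // size_filter.
rewrite -[1]addn0 iotaDl count_map /=.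
rewrite -[in RHS](mkseq_nth finset.set0 c) /mkseq count_map.
by apply: eq_count => k.
Qed.

Lemma weight_rows c : \sum_(E <- rows c) #|` E| = \sum_(C <- c) #|pred_of_set C|.
Proof.
rewrite big_map big_enum /=.
under eq_bigr do rewrite card_row -sum1_count big_mkcond.
rewrite exchange_big; apply: eq_bigr => C _; rewrite -big_mkcond sum1_card //.
Qed.

Definition nonempty_cols c := all (fun C : {set 'I_N} => 0 < #|C|) c.

Lemma bigcup_rows c : nonempty_cols c ->
  \bigcup_(E <- rows c) E = [fset i in iota 1 (size c)].
Proof.
move=> /allP c0; apply/fsetP => k; rewrite big_map.
apply/bigfcupP/idP => /= [[i _]|]; rewrite ?in_row ?inE /= mem_iota add1n ltnS.
  by case/andP.
move=> kc; have kc' : k.-1 < size c by lia.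
have /card_gt0P[i ik] := c0 _ (mem_nth finset.set0 kc').
by exists i; rewrite ?mem_enum // in_row kc.
Qed.

Lemma row_seq_rows n c : c \in col_seqs N n n -> row_seq n (rows c).
Proof.
rewrite mem_col_seqs // => /andP[c0 /eqP cn]; split.
- by move=> _ /mapP[i _ ->]; rewrite in_row.
- by exists (size c); exact: bigcup_rows.
- by rewrite weight_rows.
Qed.

Lemma rows_inj n : {in col_seqs N n n &, injective rows}.
Proof.
move=> c c'; rewrite !mem_col_seqs // => /andP[c0 _] /andP[c'0 _] cc'.
(* The union of the rows determines the number of columns; single entries are compared
   afterwards. *)
have := congr1 (fun s => #|` \bigcup_(E <- s) E|) cc'.
rewrite !bigcup_rows // !card_fseq !undup_id ?iota_uniq // !size_iota => sz.
apply: (@eq_from_nth _ finset.set0) => // k kc; apply/setP => i.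
have : row c i = row c' i.
  have := congr1 (fun s => nth fset0 s i) cc'.
  by rewrite /rows (nth_map i) ?size_enum_ord // nth_ord_enum (nth_map i) ?size_enum_ord // nth_ord_enum.
move=> /fsetP /(_ k.+1); rewrite !in_row /= -sz kc //.
Qed.

End Rows.

(** Column [k] collects the indices of the rows containing [k]; it is nonempty because the rows
    cover all of [m]. *)
Lemma row_seq_surj n s : row_seq n s ->
  exists2 c, c \in col_seqs (size s) n n & rows c = s.
Proof.
move=> [s0 [m sm] sn]; pose N := size s.
pose c := [seq [set i : 'I_N | k \in nth fset0 s i] | k <- iota 1 m].
have szc : size c = m by rewrite size_map size_iota.
have rc : rows c = s.
  rewrite -[RHS](mkseq_nth fset0) /mkseq -/N -val_enum_ord -map_comp /rows.
  apply: eq_map => i; apply/fsetP => k; rewrite in_row szc /=.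
  apply/andP/idP => [[km]|ks].
    rewrite (nth_map 0) ?size_iota; last by lia.
    by rewrite inE nth_iota ?add1n ?prednK //; lia.
  have : k \in \bigcup_(E <- s) E.
    by apply/bigfcupP; exists (nth fset0 s i); rewrite ?mem_nth.
  rewrite sm inE /= mem_iota add1n ltnS => km; split=> //.
  rewrite (nth_map 0) ?size_iota; last by lia.
  by rewrite inE nth_iota ?add1n ?prednK //; lia.
exists c => //; rewrite mem_col_seqs // -weight_rows rc sn eqxx andbT.
apply/allP => _ /mapP[k km ->]; have : k \in [fset i in iota 1 m] by rewrite inE.
rewrite -sm => /bigfcupP[E /andP[Es _] kE].
have iN : index E s < N by rewrite index_mem.
by apply/card_gt0P; exists (Ordinal iN); rewrite inE /= nth_index.
Qed.

Lemma normalized_row_seq n H s : normalized_systems n H -> perm_eq s H -> row_seq n s.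
Proof.
move=> [HS [m m0 Hm] Hn] sH; split.
- by move=> E; rewrite (perm_mem sH) => /HS[].
- by exists m; rewrite (perm_big _ sH).
- by rewrite (perm_big _ sH).
Qed.

Lemma size_normalized n H : normalized_systems n H -> size H <= n.
Proof.
move=> [HS _ <-]; rewrite /weight -sum1_size big_seq_cond [leqRHS]big_seq_cond.
by apply: leq_sum => E /andP[/HS[E0 _] _]; rewrite cardfs_gt0.
Qed.

Lemma bigcup_filter_fset0 s : \bigcup_(E <- [seq E <- s | E != fset0]) E = \bigcup_(E <- s) E.
Proof.
elim: s => [|E s IH] //=; rewrite big_cons -IH; case: eqP => [->|_] /=.
  by rewrite fset0U.
by rewrite big_cons.
Qed.

Lemma normalized_of_row_seq n s : 0 < n -> row_seq n s ->
  normalized_systems n (seq_mset [seq E <- s | E != fset0]).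
Proof.
move=> n0 [s0 [m sm] sn]; set s' := [seq _ <- s | _]; have pe := perm_eq_seq_mset s'.
split.
- by move=> E; rewrite (perm_mem pe) mem_filter => /andP[-> /s0].
- exists m; last by rewrite /vertices (perm_big _ pe) bigcup_filter_fset0.
  (* With [m = 0] all rows would be empty, against positive weight. *)
  case: m sm => // sm; move: n0; rewrite -sn big_seq big1 // => E Es.
  apply/eqP; rewrite cardfs_eq0; apply/eqP/fsetP => k; rewrite inE; apply/negbTE/negP => kE.
  have : k \in \bigcup_(E <- s) E by apply/bigfcupP; exists E; rewrite ?Es.
  by rewrite sm inE.
- rewrite /weight (perm_big _ pe) /= big_filter -sn [RHS](bigID (fun E => E != fset0)) /=.
  by rewrite [X in _ + X]big1 ?addn0 // => E /negbNE/eqP ->; rewrite cardfs0.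
Qed.

(** Finiteness is what gives the counts their meaning, as [fset_set] of an infinite set is empty.
    Every system comes from a matrix with at most [n] rows. *)
Lemma finite_normalized n : finite_set (normalized_systems n).
Proof.
pose L := flatten [seq [seq seq_mset (rows c) | c <- col_seqs e n n] | e <- iota 0 n.+1].
suff sub H : normalized_systems n H -> H \in L.
  by apply: (@sub_finite_set _ _ [set` L]%classic); [exact: sub|exact: finite_seq].
move=> HS; apply/flattenP.
have [c cn rc] := row_seq_surj (normalized_row_seq HS (perm_refl _)).
exists [seq seq_mset (rows c) | c <- col_seqs (size H) n n].
  by apply/mapP; exists (size H) => //; rewrite mem_iota ltnS size_normalized.
by apply/mapP; exists c => //; rewrite rc seq_mset_id.
Qed.

Lemma finite_simple_normalized n : finite_set (simple_normalized_systems n).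
Proof. by apply: sub_finite_set (finite_normalized n) => H []. Qed.

Definition enum_normalized n : seq {mset {fset nat}} := fset_set (normalized_systems n).
Definition enum_simple_normalized n : seq {mset {fset nat}} :=
  fset_set (simple_normalized_systems n).

Lemma mem_enum_normalized n H : H \in enum_normalized n <-> normalized_systems n H.
Proof. by rewrite /enum_normalized in_fset_set ?inE //; exact: finite_normalized. Qed.

Lemma mem_enum_simple_normalized n H :
  H \in enum_simple_normalized n <-> simple_normalized_systems n H.
Proof. by rewrite /enum_simple_normalized in_fset_set ?inE //; exact: finite_simple_normalized. Qed.

(** * Simple systems against all systems *)

Lemma simple_uniq H : simple H -> uniq H.
Proof.
move=> sH; apply: count_mem_uniq => E.
by rewrite count_mem_mset in_mset; have := sH E; case: (H E) => [|[]].
Qed.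

(** Simplicity makes all [e!] orderings of the edges distinct, orderings of different systems
    differ, and each ordering is the row sequence of a matrix with [e] rows. *)
Lemma simple_orderings n e :
  count (fun H : {mset {fset nat}} => size H == e) (enum_simple_normalized n) * e`! <= size (col_seqs e n n).
Proof.
pose S := [seq H : {mset {fset nat}} <- enum_simple_normalized n | size H == e].
pose L := flatten [seq permutations (enum_mset H) | H <- S].
have SP H : H \in S -> [/\ normalized_systems n H, simple H & size H = e].
  by rewrite mem_filter => /andP[/eqP He /mem_enum_simple_normalized[]].
have <- : size L = count (fun H : {mset {fset nat}} => size H == e) (enum_simple_normalized n) * e`!.
  rewrite size_flatten_map big_seq (eq_bigr (fun=> e`!)) => [|H /SP[_ /simple_uniq uH <-]].
    by rewrite -big_seq big_const_seq count_predT iter_addn_0 size_filter mulnC.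
  by rewrite size_permutations.
rewrite -(size_map (@rows e)); apply: uniq_leq_size => [|s].
  have -> : L = [seq s | H <- S, s <- permutations (enum_mset H)].
    by congr flatten; apply: eq_map => H; rewrite map_id.
  apply: allpairs_uniq_dep => [|H _|].
  - exact: filter_uniq (fset_uniq _).
  - exact: permutations_uniq.
  - move=> x y /allpairsPdep[H1 [s1 [_ + ->]]] /allpairsPdep[H2 [s2 [_ + ->]]] /= s12.
    rewrite !mem_permutations s12 perm_sym => p1 p2; have := perm_trans p1 p2.
    by move=> /eq_seq_msetP; rewrite !seq_mset_id => ->.
move=> /flattenP[_ /mapP[H /SP[HN _ He] ->]]; rewrite mem_permutations => sH.
move: (perm_size sH) (row_seq_surj (normalized_row_seq HN sH)); rewrite He => ->.
by case=> c cn <-; exact: map_f.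
Qed.

(** Deleting empty rows and forgetting the order maps matrices to systems; the matrices over [H] are
    placements of its edges in [N] rows with filler [fset0]. *)
Lemma size_col_seqs_le_placements N n : 0 < n ->
  size (col_seqs N n n) <= \sum_(H <- enum_normalized n) N ^_ (size H).
Proof.
move=> n0.
apply: (leq_size_sum_fibers
  (f := fun c => seq_mset [seq E <- rows c | E != fset0] : {mset {fset nat}})) => [c cn|H _].
  by apply/mem_enum_normalized/normalized_of_row_seq => //; exact: row_seq_rows.
rewrite -size_filter; apply: leq_trans (size_placements (fset0 : {fset nat}) N (enum_mset H)).
apply: (leq_size_in_inj (f := @rows N)).
- by rewrite filter_uniq // col_seqs_uniq.
- by move=> c c'; rewrite !mem_filter => /andP[_ cn] /andP[_ c'n]; exact: rows_inj cn c'n.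
- move=> c; rewrite mem_filter => /andP[/eqP cH _].
  apply: mem_placements; first exact: size_rows.
  by rewrite -cH perm_sym; exact: perm_eq_seq_mset.
Qed.

Definition support H : {mset {fset nat}} := seq_mset (finsupp H).

Lemma perm_support H : perm_eq (support H) (finsupp H).
Proof. exact: perm_eq_seq_mset. Qed.

Lemma mem_support H E : (E \in support H) = (E \in H).
Proof. by rewrite (perm_mem (perm_support H)) msuppE. Qed.

Lemma support_simple H : simple (support H).
Proof. by move=> E; rewrite mset_seqE count_uniq_mem ?fset_uniq // leq_b1. Qed.

Lemma vertices_support H : vertices (support H) = vertices H.
Proof.
rewrite /vertices; apply/fsetP => k; apply/bigfcupP/bigfcupP => -[E /andP[EH _] kE];
  exists E => //; by move: EH; rewrite andbT mem_support.
Qed.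

Lemma weight_support H :
  weight H = weight (support H) + \sum_(E <- support H) (H E).-1 * #|` E|.
Proof.
rewrite /weight sum_mset !(perm_big _ (perm_support H)) /= -big_split /=.
rewrite big_seq [RHS]big_seq; apply: eq_bigr => E.
by rewrite mem_finsupp -lt0n => HE; rewrite -{1}(prednK HE) mulSn.
Qed.

Lemma support_normalized n H : normalized_systems n H ->
  simple_normalized_systems (weight (support H)) (support H).
Proof.
move=> [HS [m m0 Hm] Hn]; split; last exact: support_simple.
split=> //; last by exists m => //; rewrite vertices_support.
by move=> E; rewrite mem_support; exact: HS.
Qed.

(* A system is recovered from its support and the multiplicities minus one,
   whose sum is at most the weight lost by passing to the support. *)
Lemma size_enum_normalized_le n q : 0 < q ->
  size (enum_normalized n) * q.-1 ^ n <=
  \sum_(t < n.+1) size (enum_simple_normalized (n - t)) * q ^ (t + n).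
Proof.
move=> q0; pose L := flatten [seq enum_simple_normalized (n - t) | t <- iota 0 n.+1].
pose B (S : {mset {fset nat}}) := size (bounded_seqs (size S) (n - weight S)).
pose mult (S H : {mset {fset nat}}) := [seq (H E).-1 | E <- enum_mset S].
have mult_inj (S H H' : {mset {fset nat}}) :
    support H = S -> support H' = S -> mult S H = mult S H' -> H = H'.
  move=> HS H'S HH'; apply/msetP => E; have [ES|ES] := boolP (E \in S).
    have : (H E).-1 = (H' E).-1.
      have := congr1 (fun l : seq nat => nth 0 l (index E (enum_mset S))) HH'.
      by rewrite !(nth_map fset0) ?index_mem // nth_index.
    have : 0 < H E by rewrite -in_mset -mem_support HS.
    have : 0 < H' E by rewrite -in_mset -mem_support H'S.
    by case: (H E) (H' E) => [|a] [|b] //= _ _ ->.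
  have /mset_eq0P -> : E \notin H by rewrite -mem_support HS.
  by have /mset_eq0P -> : E \notin H' by rewrite -mem_support H'S.
have fib (S : {mset {fset nat}}) :
    count (fun H => support H == S) (enum_normalized n) <= B S.
  rewrite -size_filter; apply: (leq_size_in_inj (f := mult S)).
  - exact: filter_uniq (fset_uniq _).
  - move=> H H'; rewrite !mem_filter => /andP[/eqP HS _] /andP[/eqP H'S _].
    exact: mult_inj.
  - move=> H; rewrite mem_filter => /andP[/eqP <- /mem_enum_normalized[HS _ Hn]].
    apply: mem_bounded_seqs; first by rewrite size_map.
    (* Edges are nonempty, so each surplus copy accounts for at least one unit of the lost
       weight. *)
    rewrite sumnE big_map -Hn (weight_support H) addKn big_seq [leqRHS]big_seq.
    apply: leq_sum => E; rewrite mem_support => /HS[E0 _].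
    by rewrite leq_pmulr // cardfs_gt0.
have ple m : q.-1 ^ m <= q ^ m by case: m => // m; rewrite leq_exp2r ?leq_pred.
(* [size_bounded_seqs] uses only [size S] factors [q.-1]; the remaining ones are bounded by [q],
   which makes the bound independent of [S]. *)
have Bq t (S : {mset {fset nat}}) : t <= n -> normalized_systems (n - t) S ->
    B S * q.-1 ^ n <= q ^ (t + n).
  move=> tn SN; have SnB := size_normalized SN; have [_ _ Sw] := SN.
  rewrite /B Sw subKn //.
  have Sn : size S <= n by rewrite (leq_trans SnB) // leq_subr.
  rewrite -[X in q.-1 ^ X](subnKC Sn) expnD mulnA.
  apply: leq_trans (leq_mul (size_bounded_seqs _ _ q0) (leqnn _)) _.
  rewrite -[X in _ <= q ^ (t + X)](subnKC Sn) addnA [leqRHS]expnD leq_mul2l.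
  by rewrite ple orbT.
have : size (enum_normalized n) <= \sum_(S <- L) B S.
  apply: (leq_size_sum_fibers (f := support)) => [H /mem_enum_normalized HN|? _]; last exact: fib.
  have [_ _ Hn] := HN; have wn : weight (support H) <= n by rewrite -Hn (weight_support H) leq_addr.
  apply/flattenP; exists (enum_simple_normalized (weight (support H))).
    apply/mapP; exists (n - weight (support H)); first by rewrite mem_iota ltnS leq_subr.
    by rewrite subKn.
  by apply/mem_enum_simple_normalized; exact: support_normalized HN.
move=> /(leq_mul (leqnn (q.-1 ^ n))); rewrite mulnC => /leq_trans; apply.
rewrite /L big_flatten big_map mulnC big_distrl.
rewrite (_ : iota 0 n.+1 = index_iota 0 n.+1); last by rewrite /index_iota subn0.
rewrite big_mkord; apply: leq_sum => t _; have tn : t <= n by rewrite -ltnS.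
rewrite big_distrl /= -sum1_size big_distrl /= big_seq [leqRHS]big_seq.
by apply: leq_sum => S /mem_enum_simple_normalized[SN _]; rewrite mul1n; exact: Bq.
Qed.

Lemma size_enum_simple_normalizedS n :
  size (enum_simple_normalized n) <= size (enum_simple_normalized n.+1).
Proof.
pose top H : {fset nat} := [fset #|` vertices H|.+1].
pose F H : {mset {fset nat}} := top H +` H.
have normP H : H \in enum_simple_normalized n ->
    [/\ normalized_systems n H, simple H &
        vertices H = [fset i in iota 1 #|` vertices H|]].
  move=> /mem_enum_simple_normalized[HN sH]; have [_ [m m0 Hm] _] := HN.
  have cm : #|` vertices H| = m by rewrite Hm card_fseq undup_id ?iota_uniq // size_iota.
  by split; rewrite ?cm.
have vF H : vertices (F H) = (top H `|` vertices H)%fset.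
  rewrite /vertices; apply/fsetP => k; rewrite in_fsetU; apply/bigfcupP/orP => /=.
    move=> [E]; rewrite in_mset1D andbT => /orP[/eqP ->|EH] kE; first by left.
    by right; apply/bigfcupP; exists E; rewrite ?EH.
  move=> [kt|/bigfcupP[E /andP[EH _] kE]]; first by exists (top H); rewrite ?in_mset1D ?eqxx.
  by exists E; rewrite ?in_mset1D ?EH ?orbT.
have snoc_interval (k v : nat) :
    (k == v.+1) || (0 < k <= v) = (k == 1) || (1 < k <= v.+1) by lia.
have vF' H : H \in enum_simple_normalized n ->
    vertices (F H) = [fset i in iota 1 #|` vertices H|.+1].
  move=> /normP[_ _ Hm]; rewrite vF [X in (_ `|` X)%fset]Hm; apply/fsetP => k.
  rewrite in_fsetU !inE /= !mem_iota !add1n !ltnS.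
  exact: snoc_interval.
have topN H : H \in enum_simple_normalized n -> top H \notin H.
  move=> /normP[_ _ Hm]; apply/negP => tH.
  have : #|` vertices H|.+1 \in vertices H.
    by apply/bigfcupP; exists (top H); rewrite ?tH ?inE.
  by rewrite [X in _ \in X]Hm inE /= mem_iota add1n ltnn andbF.
apply: (leq_size_in_inj (f := F)).
- exact: fset_uniq.
- move=> H H' HN H'N FF'.
  (* Equal images have equally many vertices, hence the same singleton was added to both systems. *)
  have cc' : #|` vertices H| = #|` vertices H'|.
    have := congr1 (fun H => #|` vertices H|) FF'.
    by rewrite !vF' // !card_fseq !undup_id ?iota_uniq // !size_iota => -[].
  apply/msetP => E; have /msetP/(_ E) := FF'.
  by rewrite /F /top cc' !mset1DE => /addnI.
- move=> H HN; have [[HS _ Hw] sH Hm] := normP _ HN.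
  apply/mem_enum_simple_normalized; split; first split.
  + move=> E; rewrite in_mset1D => /orP[/eqP ->|/HS //].
    by rewrite -cardfs_gt0 cardfs1 inE.
  + by exists #|` vertices H|.+1; rewrite ?vF'.
  + rewrite /weight (perm_big (top H :: enum_mset H)) /=.
      by rewrite big_cons cardfs1 add1n -/(weight H) Hw.
    by apply/allP => E _ /=; rewrite !count_mem_mset mset1DE (eq_sym E).
  + move=> E; rewrite mset1DE; case: eqP => [->|_]; last exact: sH.
    by have /mset_eq0P -> := topN _ HN.
Qed.

(** * Estimates *)

Local Open Scope classical_set_scope.
Local Open Scope ring_scope.

(** * Exponential bounds for the number of matrices *)

Section ColumnBounds.
Variable R : realFieldType.
Implicit Types x : R.

Lemma ler_bin_exp N d : 'C(N, d)%:R <= N%:R ^+ d / d`!%:R :> R.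
Proof.
rewrite ler_pdivlMr ?ltr0n ?fact_gt0 // -natrX -natrM ler_nat bin_ffact.
elim: d => [|d IH]; first by rewrite ffactn0.
by rewrite ffactnSr expnSr leq_mul // leq_subr.
Qed.

(** Induction along the column recursion: after ['C(N, d) <= N ^ d / d!], the hypothesis on [x] is
    exactly what makes the terms add up to at most [N ^ n]. *)
Lemma size_col_seqs_le N f n x : (n <= f)%N -> 0 <= x ->
  (forall m, \sum_(d < m) x ^+ d.+1 / d.+1`!%:R <= 1) ->
  (size (col_seqs N f n))%:R * x ^+ n <= N%:R ^+ n.
Proof.
move=> nf x0 xS; elim: f n nf => [|f IH] [|n] // nf; try by rewrite !expr0 mulr1.
rewrite size_col_seqsS natr_sum mulr_suml.
apply: (@le_trans _ _ (\sum_(d < n.+1) N%:R ^+ n.+1 * (x ^+ d.+1 / d.+1`!%:R))).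
  apply: ler_sum => d _; have dn : (d <= n)%N by rewrite -ltnS.
  have nE : (n.+1 = d.+1 + (n - d))%N by rewrite addSn subnKC.
  rewrite [X in _ * x ^+ X <= _]nE [X in _ <= _ ^+ X * _]nE !exprD natrM.
  have H1 := ler_bin_exp N d.+1.
  have H2 := IH (n - d)%N (leq_trans (leq_subr d n) nf).
  have -> : ('C(N, d.+1))%:R * (size (col_seqs N f (n - d)))%:R * (x ^+ d.+1 * x ^+ (n - d))
     = ('C(N, d.+1)%:R * x ^+ d.+1) * ((size (col_seqs N f (n - d)))%:R * x ^+ (n - d)) :> R by ring.
  have -> : N%:R ^+ d.+1 * N%:R ^+ (n - d) * (x ^+ d.+1 / (d.+1)`!%:R) =
     (N%:R ^+ d.+1 / (d.+1)`!%:R * x ^+ d.+1) * N%:R ^+ (n - d) :> R by ring.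
  apply: ler_pM => //; rewrite ?mulr_ge0 ?exprn_ge0 ?ler0n //.
  by rewrite ler_wpM2r ?exprn_ge0.
by rewrite -mulr_sumr ler_piMr ?exprn_ge0 ?ler0n.
Qed.

(** The [k] extra rows keep every factor of the falling factorial at least [M]. *)
Lemma ler_exp_bin M k d : (d <= k)%N -> M%:R ^+ d / d`!%:R <= 'C(M + k, d)%:R :> R.
Proof.
move=> dk; rewrite ler_pdivrMr ?ltr0n ?fact_gt0 // -natrX -natrM ler_nat bin_ffact.
elim: d dk => [|d IH] dk; first by rewrite ffactn0.
by rewrite ffactnSr expnSr leq_mul ?IH 1?ltnW //; lia.
Qed.

(** For [n >= k] the columns of size at most [k] already carry the induction. The factor [x ^+ k]
    pays for the weights below [k], where the recursion has too few terms. *)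
Lemma size_col_seqs_ge M k f n x : (n <= f)%N -> 0 < x <= 1 ->
  1 <= \sum_(d < k) x ^+ d.+1 / d.+1`!%:R ->
  x ^+ k * M%:R ^+ n <= (size (col_seqs (M + k) f n))%:R * x ^+ n.
Proof.
move=> nf /andP[x0 x1] xS.
(* Matrices whose columns are all singletons are enough here. *)
have small : forall f' n', (n' <= f')%N -> ((M + k) ^ n' <= size (col_seqs (M + k) f' n'))%N.
  elim=> [|f' IH] [|n'] // nf'; rewrite size_col_seqsS big_ord_recl /= bin1 subn0 expnS.
  by rewrite (leq_trans _ (leq_addr _ _)) // leq_mul2l IH ?orbT.
elim: f n nf => [|f IH] n nf.
  move: nf; rewrite leqn0 => /eqP ->; rewrite !expr0 !mulr1 exprn_ile1 //; exact: ltW.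
have [nk|kn] := ltnP n k.
  rewrite mulrC; apply: ler_pM; rewrite ?exprn_ge0 ?ler0n ?(ltW x0) //.
    rewrite -natrX ler_nat (leq_trans _ (small _ _ nf)) //.
    by case: (n) => [|m]; rewrite ?expn0 // leq_exp2r ?leq_addr.
  by rewrite ler_wiXn2l // ?(ltW x0) // ltnW.
have k0 : (0 < k)%N by case: (k) xS => //; rewrite big_ord0 ler10.
case: n nf kn => [|n] nf kn; first by move: kn; rewrite leqn0 => /eqP kn; rewrite kn in k0.
rewrite size_col_seqsS natr_sum mulr_suml.
apply: (@le_trans _ _ (\sum_(d < k) x ^+ k * M%:R ^+ n.+1 * (x ^+ d.+1 / d.+1`!%:R))).
  by rewrite -mulr_sumr ler_peMr // mulr_ge0 ?exprn_ge0 ?ler0n ?(ltW x0).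
rewrite (big_ord_widen n.+1 (fun d => x ^+ k * M%:R ^+ n.+1 * (x ^+ d.+1 / d.+1`!%:R))) //.
rewrite big_mkcond; apply: ler_sum => d _; have dn : (d <= n)%N by rewrite -ltnS.
case: ifP => dk; last by rewrite mulr_ge0 ?exprn_ge0 ?ler0n ?(ltW x0).
have H1 := ler_exp_bin M dk.
have H2 := IH (n - d)%N (leq_trans (leq_subr d n) nf).
have nE : (n.+1 = d.+1 + (n - d))%N by rewrite addSn subnKC.
rewrite [X in _ <= _ * x ^+ X]nE [X in _ * _ ^+ X * _ <= _]nE !exprD natrM.
have -> : ('C(M + k, d.+1))%:R * (size (col_seqs (M + k) f (n - d)))%:R * (x ^+ d.+1 * x ^+ (n - d))
   = ('C(M + k, d.+1)%:R * x ^+ d.+1) * ((size (col_seqs (M + k) f (n - d)))%:R * x ^+ (n - d)) :> R by ring.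
have -> : x ^+ k * (M%:R ^+ d.+1 * M%:R ^+ (n - d)) * (x ^+ d.+1 / (d.+1)`!%:R) =
   (M%:R ^+ d.+1 / (d.+1)`!%:R * x ^+ d.+1) * (x ^+ k * M%:R ^+ (n - d)) :> R by ring.
apply: ler_pM => //; rewrite ?mulr_ge0 ?invr_ge0 ?exprn_ge0 ?ler0n ?(ltW x0) //.
by rewrite ler_pM2r ?exprn_gt0.
Qed.

End ColumnBounds.

(** * The exponential series and numerical bounds for log 2 *)

Section Exponential.
Variable R : realType.
Implicit Types x y : R.

Lemma cvg_exp_sum x : \sum_(d < n) x ^+ d / d`!%:R @[n --> \oo] --> expR x.
Proof.
have -> : (fun n => \sum_(d < n) x ^+ d / d`!%:R) = series (exp_coeff x).
  by apply/funext => n; rewrite seriesEord.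
exact: is_cvg_series_exp_coeff.
Qed.

Lemma exp_sum_le x n : 0 <= x -> \sum_(d < n) x ^+ d / d`!%:R <= expR x.
Proof.
move=> x0; have cv := @cvg_exp_sum x; rewrite -(cvg_lim _ cv) //.
apply: (@nondecreasing_cvgn_le R (fun n => \sum_(d < n) x ^+ d / d`!%:R)).
  apply/nondecreasing_seqP => m; rewrite big_ord_recr /= lerDl.
  by rewrite divr_ge0 ?exprn_ge0 ?ler0n.
by apply/cvg_ex; exists (expR x).
Qed.

(** Since [(n + j)! >= n!], the tail is dominated by a geometric series of ratio [x]. *)
Lemma exp_le_sum x n : 0 < x < 1 ->
  expR x <= \sum_(d < n) x ^+ d / d`!%:R + x ^+ n / n`!%:R / (1 - x).
Proof.
move=> /andP[x0 x1]; set B := (X in _ <= X).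
have cv := @cvg_exp_sum x.
rewrite -(cvg_lim _ cv) //; apply: limr_le; first by apply/cvg_ex; exists (expR x).
near=> m; have nm : (n <= m)%N by near: m; exact: nbhs_infty_ge.
rewrite -(subnKC nm) big_split_ord /= /B lerD2l.
apply: (@le_trans _ _ (x ^+ n / n`!%:R * \sum_(j < m - n) x ^+ j)).
  rewrite mulr_sumr; apply: ler_sum => j _; rewrite exprD mulrAC.
  rewrite ler_wpM2r ?exprn_ge0 ?(ltW x0) // ler_wpM2l ?exprn_ge0 ?(ltW x0) //.
  by rewrite lef_pV2 ?posrE ?ltr0n ?fact_gt0 // ler_nat leq_fact ?leq_addr.
rewrite ler_wpM2l ?divr_ge0 ?exprn_ge0 ?ler0n ?(ltW x0) //.
have := @geometric_le_lim R (m - n) 1 x ler01 x0; rewrite gtr0_norm // => /(_ x1).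
rewrite div1r seriesEord /=; apply: le_trans.
by rewrite le_eqVlt; apply/orP; left; apply/eqP/eq_bigr => j _; rewrite mul1r.
Unshelve. all: by end_near.
Qed.

(** These are partial sums of the series of [expR (ln 2) - 1 = 1]. *)
Lemma ln2_sum_le1 n : \sum_(d < n) (ln 2 : R) ^+ d.+1 / d.+1`!%:R <= 1.
Proof.
have l0 : 0 <= ln 2 :> R by rewrite ltW // ln_gt0 // ltr1n.
have := exp_sum_le n.+1 l0; rewrite lnK ?posrE ?ltr0n // big_ord_recl expr0 fact0 divr1.
by rewrite -lerBrDl => /le_trans; apply; lra.
Qed.

Lemma gt_ln2_sum_ge1 x : ln 2 < x -> exists k, 1 <= \sum_(d < k) x ^+ d.+1 / d.+1`!%:R.
Proof.
move=> xl; have e2 : 2 < expR x by rewrite -[ltLHS]lnK ?posrE ?ltr0n // ltr_expR.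
have /cvgr_ge /(_ 2 e2) := @cvg_exp_sum x.
case=> k _ /(_ k.+1 (leqnSn _)) /=; rewrite big_ord_recl expr0 fact0 divr1 => H.
by exists k; rewrite -(lerD2l 1); apply: le_trans H; lra.
Qed.

(** The exponentials of 0.693145 and 0.693149 are compared with 2 through ten terms of the series;
    the interval is narrow enough to fix five decimals of 1 / log 2. *)
Lemma ln2_bounds :
  (693 * 10 ^+ 3 + 145) / 10 ^+ 6 < ln (2 : R) < (693 * 10 ^+ 3 + 149) / 10 ^+ 6.
Proof.
(* Abstracting the inverse factorials keeps them from being evaluated in unary. *)
pose c d : R := d`!%:R^-1.
have c0 : c 0%N = 1 by rewrite /c fact0 invr1.
have cS k : c k.+1 = c k / k.+1%:R by rewrite /c factS natrM invfM mulrC.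
have lo (a : R) : a = (693 * 10 ^+ 3 + 145) / 10 ^+ 6 ->
    \sum_(d < 10) a ^+ d * c d + a ^+ 10 * c 10%N / (1 - a) < 2.
  clearbody c => aE.
  have a1 : (1 - a)^-1 <= 4 by rewrite -[leRHS]invrK lef_pV2 ?posrE ?aE; lra.
  have cp : 0 <= a ^+ 10 * c 10%N by rewrite !cS c0 aE; lra.
  have := ler_wpM2l cp a1; move: ((1 - a)^-1) {cp a1} => u.
  rewrite -(big_mkord xpredT (fun d => a ^+ d * c d)).
  by rewrite !big_nat_recr //= big_geq // !cS c0 aE; lra.
have hi (a : R) : a = (693 * 10 ^+ 3 + 149) / 10 ^+ 6 -> 2 < \sum_(d < 10) a ^+ d * c d.
  clearbody c => aE.
  rewrite -(big_mkord xpredT (fun d => a ^+ d * c d)).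
  by rewrite !big_nat_recr //= big_geq // !cS c0 aE; lra.
apply/andP; split; rewrite -ltr_expR lnK ?posrE ?ltr0n //.
- by apply: le_lt_trans (exp_le_sum 10 _) (lo _ erefl); lra.
- by apply: lt_le_trans (hi _ erefl) (exp_sum_le 10 _); lra.
Qed.

(** With [y = ln x], the single term of degree [k] in the series of [expR (y * (n + k))] already
    dominates. *)
Lemma polynomial_le_exponential k x : 1 < x ->
  exists2 C, 0 < C & forall n : nat, (n + k)%:R ^+ k <= C * x ^+ n.
Proof.
move=> x1; pose y := ln x.
have x0 : 0 < x by rewrite (lt_trans _ x1).
have y0 : 0 < y by rewrite ln_gt0.
exists (k`!%:R / y ^+ k * expR (y * k%:R)).
  by rewrite mulr_gt0 ?expR_gt0 // divr_gt0 ?exprn_gt0 // ltr0n fact_gt0.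
move=> n; have yk0 : 0 < y ^+ k by rewrite exprn_gt0.
have fk0 : 0 < k`!%:R :> R by rewrite ltr0n fact_gt0.
have -> : x ^+ n = expR (y * n%:R) by rewrite expRM_natr lnK ?posrE.
rewrite -[leRHS]mulrA -expRD -mulrDr -natrD [(k + n)%N]addnC; set m := (n + k)%N.
have ym0 : 0 <= y * m%:R by rewrite mulr_ge0 ?ler0n ?(ltW y0).
have := exp_sum_le k.+1 ym0; rewrite big_ord_recr /= => H.
have {}H : (y * m%:R) ^+ k / k`!%:R <= expR (y * m%:R).
  apply: le_trans H; rewrite lerDr sumr_ge0 // => i _.
  by rewrite divr_ge0 ?exprn_ge0 ?ler0n.
rewrite mulrAC ler_pdivlMr // -ler_pdivrMl // mulrC -exprMn mulrC.
by rewrite mulrC (mulrC m%:R).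
Qed.

End Exponential.

(** * Truncated Dobinski sums *)

Section Dobinski.
Variable R : realType.

(* A truncation of Dobinski's series for e * bell n. *)
Definition dobinski n : R := \sum_(N < n.+1) N%:R ^+ n / N`!%:R.

Lemma dobinski_ge1 n : 1 <= dobinski n.
Proof.
rewrite /dobinski; case: n => [|n].
  by rewrite big_ord_recl big_ord0 expr0 fact0 divr1 addr0.
rewrite (bigD1 (Ordinal (isT : (1 < n.+2)%N))) //= expr1n (factS 0) fact0 muln1 divr1 lerDl.
by apply: sumr_ge0 => i _; rewrite divr_ge0 ?exprn_ge0 ?ler0n.
Qed.

(** Terms with [N > K] gain at least [K ^ t] from the larger exponent. The others contribute at most
    e times [K ^ (m + t)], which is controlled by the term [N = K] of the larger sum, or by a
    constant if that sum stops before [K]. *)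
Lemma dobinski_growth (K : nat) :
  exists2 C : R, 0 < C & forall m t, dobinski m * K%:R ^+ t <= C * dobinski (m + t).
Proof.
pose C' : R := K`!%:R + K%:R ^+ K + 1.
exists (1 + expR 1 * C').
  by rewrite addr_gt0 // mulr_gt0 ?expR_gt0 // ltr_wpDl // addr_ge0 ?exprn_ge0 ?ler0n.
move=> m t; set n := (m + t)%N.
have Kn : K%:R ^+ n <= C' * dobinski n.
  have [nK|Kn] := ltnP n K.
    apply: (@le_trans _ _ C'); last by rewrite ler_peMr ?dobinski_ge1 // !addr_ge0 ?exprn_ge0 ?ler0n.
    have : K%:R ^+ n <= K%:R ^+ K :> R by rewrite ler_weXn2l ?ler1n ?(leq_ltn_trans (leq0n n) nK) ?(ltnW nK).
    have : 0 <= K`!%:R :> R by rewrite ler0n.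
    rewrite /C'; lra.
  have : K%:R ^+ n / K`!%:R <= dobinski n.
    rewrite /dobinski (bigD1 (Ordinal (Kn : (K < n.+1)%N))) //= lerDl.
    by apply: sumr_ge0 => i _; rewrite divr_ge0 ?exprn_ge0 ?ler0n.
  rewrite ler_pdivrMr ?ltr0n ?fact_gt0 // mulrC => /le_trans; apply.
  rewrite ler_wpM2r ?(le_trans _ (dobinski_ge1 n)) // /C'.
  have : 0 <= K%:R ^+ K :> R by rewrite exprn_ge0 ?ler0n.
  lra.
apply: (@le_trans _ _ (dobinski n + expR 1 * K%:R ^+ n)); last first.
  by rewrite mulrDl mul1r lerD2l -mulrA ler_wpM2l // expR_ge0.
apply: (@le_trans _ _ (\sum_(N < m.+1) (N%:R ^+ n / N`!%:R + K%:R ^+ n / N`!%:R))).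
  rewrite /dobinski mulr_suml; apply: ler_sum => N _.
  rewrite mulrAC -mulrDl ler_wpM2r ?invr_ge0 ?ler0n //.
  have [NK|KN] := leqP N K.
    apply: (@le_trans _ _ (K%:R ^+ n)); last by rewrite lerDr exprn_ge0 ?ler0n.
    by rewrite /n exprD ler_wpM2r ?exprn_ge0 ?ler0n // lerXn2r ?nnegrE ?ler0n ?ler_nat.
  apply: (@le_trans _ _ (N%:R ^+ n)); last by rewrite lerDl exprn_ge0 ?ler0n.
  by rewrite /n exprD ler_wpM2l ?exprn_ge0 ?ler0n // lerXn2r ?nnegrE ?ler0n ?ler_nat ?(ltnW KN).
rewrite big_split /= lerD //.
  rewrite /dobinski (big_ord_widen n.+1 (fun N => N%:R ^+ n / N`!%:R)) ?ltnS ?leq_addr //.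
  by rewrite big_mkcond ler_sum // => i _; case: ifP => // _; rewrite divr_ge0 ?exprn_ge0 ?ler0n.
rewrite -mulr_sumr mulrC ler_wpM2r ?exprn_ge0 ?ler0n //.
apply: le_trans (exp_sum_le m.+1 ler01).
by apply: ler_sum => i _; rewrite expr1n mul1r.
Qed.

(** Terms with [N < e] vanish and the others equal [1 / (N - e)!]. *)
Lemma ffact_fact_sum_le e X : \sum_(N < X.+1) (N ^_ e)%:R / N`!%:R <= expR 1 :> R.
Proof.
apply: le_trans (exp_sum_le X.+1 ler01).
have [eX|Xe] := leqP X.+1 e.
  rewrite big1 => [|i _]; last by rewrite ffact_small ?mul0r // (leq_trans (ltn_ord i)).
  by apply: sumr_ge0 => i _; rewrite divr_ge0 ?exprn_ge0 ?ler0n.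
rewrite -(big_mkord xpredT (fun N => (N ^_ e)%:R / N`!%:R)) (@big_cat_nat _ _ _ e) //=; last exact: ltnW.
rewrite [X in X + _]big_nat big1 ?add0r => [|i /andP[_ ie]]; last by rewrite ffact_small // mul0r.
rewrite -{1}[e]add0n big_addn big_mkord.
apply: (@le_trans _ _ (\sum_(d < X.+1 - e) 1 / d`!%:R)).
  apply: ler_sum => i _; rewrite -(@ffact_fact (i + e) e) ?leq_addl // addnK natrM invfM mulrA divff //.
  by rewrite pnatr_eq0 -lt0n ffact_gt0 leq_addl.
rewrite (big_ord_widen X.+1 (fun d => 1 / d`!%:R)) ?leq_subr // big_mkcond.
by apply: ler_sum => i _; case: ifP => // _; rewrite expr1n // divr_ge0 ?ler0n.
Qed.

Lemma ffact_fact_sum_ge e X : (e <= X)%N -> 1 <= \sum_(N < X.+1) (N ^_ e)%:R / N`!%:R :> R.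
Proof.
move=> eX; rewrite (bigD1 (Ordinal (eX : (e < X.+1)%N))) //= ffactnn divff ?pnatr_eq0 -?lt0n ?fact_gt0 //.
by rewrite lerDl; apply: sumr_ge0 => i _; rewrite divr_ge0 ?ler0n.
Qed.

End Dobinski.

(** * Inequalities between the counts, D(n) and the Bell numbers *)

Section Counting.
Variable R : realType.
Local Notation D := (@dobinski R).
Local Notation l := (ln (2 : R)).
Local Notation h1 n := ((num_simple_normalized n)%:R : R).
Local Notation h2 n := ((num_normalized n)%:R : R).

Lemma ln2_gt0 : 0 < l. Proof. by rewrite ln_gt0 // ltr1n. Qed.

Lemma ln2_lt1 : l < 1.
Proof. by have /andP[_] := ln2_bounds R; move=> /lt_trans; apply; lra. Qed.

Lemma dobinskiE n :
  D n = \sum_(P : {set {set 'I_n}} | finset.partition P [set: 'I_n]%SET)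
          \sum_(N < n.+1) (N ^_ #|P|)%:R / N`!%:R.
Proof.
rewrite exchange_big; apply: eq_bigr => N _ /=; rewrite -mulr_suml -natr_sum.
by rewrite (@sum_ffact_partition 'I_n N) card_ord natrX.
Qed.

Lemma bellE n :
  (bell n)%:R = \sum_(P : {set {set 'I_n}} | finset.partition P [set: 'I_n]%SET) 1 :> R.
Proof. by rewrite /bell -sum1_card natr_sum; apply: eq_bigl => P; rewrite inE. Qed.

(** A partition has at most [n] blocks, so the truncation at [N = n] retains the term [N = #|P|],
    which equals 1. *)
Lemma bell_le_dobinski n : (bell n)%:R <= D n.
Proof.
rewrite dobinskiE bellE; apply: ler_sum => P PP; apply: ffact_fact_sum_ge.
by rewrite (leq_trans (card_partition_leq PP)) // card_ord.
Qed.

Lemma dobinski_le_bell n : D n <= expR 1 * (bell n)%:R.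
Proof.
rewrite dobinskiE bellE mulr_sumr; apply: ler_sum => P _; rewrite mulr1.
exact: ffact_fact_sum_le.
Qed.

(** Systems with [e] edges number at most A(e, n) / e!, which is at most [e ^ n / e!] times l^-n;
    summing over [e] produces D(n). *)
Lemma num_simple_normalized_le n : h1 n * l ^+ n <= D n.
Proof.
have : (num_simple_normalized n <= \sum_(e <- iota 0 n.+1)
    count (fun H : {mset {fset nat}} => size H == e) (enum_simple_normalized n))%N.
  apply: (leq_size_sum_fibers (f := fun H : {mset {fset nat}} => size H)) => // H.
  by move=> /mem_enum_simple_normalized[HN _]; rewrite mem_iota ltnS size_normalized.
rewrite (_ : iota 0 n.+1 = index_iota 0 n.+1); last by rewrite /index_iota subn0.
rewrite big_mkord -(ler_nat R) natr_sum => H.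
apply: le_trans (ler_wpM2r (exprn_ge0 n (ltW ln2_gt0)) H) _.
rewrite mulr_suml; apply: ler_sum => e _.
rewrite ler_pdivlMr ?ltr0n ?fact_gt0 // mulrAC -natrM.
apply: le_trans (size_col_seqs_le e (leqnn n) (ltW ln2_gt0) (@ln2_sum_le1 R)).
by rewrite ler_wpM2r ?exprn_ge0 ?(ltW ln2_gt0) // ler_nat simple_orderings.
Qed.

Lemma fact_addn_le M k B : (M + k <= B)%N -> ((M + k)`! <= M`! * B ^ k)%N.
Proof.
elim: k => [|k IH] MB; first by rewrite addn0 muln1.
by rewrite addnS factS expnS mulnCA leq_mul -?addnS ?IH //; lia.
Qed.

(** Summed over N with weights 1 / N!, the placements of one system contribute at most e, so the sum
    of A(N, n) / N! is at most e h''(n). The terms [N = M + k] are bounded below by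
    [size_col_seqs_ge]; replacing [(M + k)!] by [M!] costs the polynomial factor. *)
Lemma num_normalized_ge n k (x : R) : (0 < n)%N -> 0 < x <= 1 ->
  1 <= \sum_(d < k) x ^+ d.+1 / d.+1`!%:R ->
  x ^+ k * D n <= expR 1 * (n + k)%:R ^+ k * x ^+ n * h2 n.
Proof.
move=> n0 x01 xS; have /andP[x0 x1] := x01.
have H1 : \sum_(N < (k + n).+1) (size (col_seqs N n n))%:R / N`!%:R <= expR 1 * h2 n.
  apply: (@le_trans _ _ (\sum_(H <- enum_normalized n)
      \sum_(N < (k + n).+1) (N ^_ (size (enum_mset H)))%:R / N`!%:R)).
    rewrite exchange_big; apply: ler_sum => N _ /=.
    rewrite -mulr_suml -natr_sum ler_wpM2r ?invr_ge0 ?ler0n // ler_nat.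
    exact: size_col_seqs_le_placements.
  apply: (@le_trans _ _ (\sum_(H <- enum_normalized n) expR 1)).
    by apply: ler_sum => H _; exact: ffact_fact_sum_le.
  by rewrite big_const_seq count_predT iter_addr addr0 -[leLHS]mulr_natr lexx.
have H2 : \sum_(M < n.+1) (size (col_seqs (M + k) n n))%:R / (M + k)`!%:R <= expR 1 * h2 n.
  apply: le_trans H1; rewrite -addnS big_split_ord /= -[leLHS]add0r lerD //.
    by apply: sumr_ge0 => i _; rewrite divr_ge0 ?ler0n.
  by apply: ler_sum => i _; rewrite addnC.
have p0 : 0 <= (n + k)%:R ^+ k * x ^+ n by rewrite mulr_ge0 ?exprn_ge0 ?ler0n ?(ltW x0).
apply: (@le_trans _ _ ((n + k)%:R ^+ k * x ^+ n * (expR 1 * h2 n))); last first.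
  by rewrite le_eqVlt; apply/orP; left; apply/eqP; ring.
apply: le_trans (ler_wpM2l p0 H2); rewrite /dobinski !mulr_sumr; apply: ler_sum => M _.
have Mn : (M <= n)%N by rewrite -ltnS.
have HA := size_col_seqs_ge M (leqnn n) x01 xS.
have HB : M`!%:R^-1 <= (n + k)%:R ^+ k / (M + k)`!%:R :> R.
  rewrite ler_pdivlMr ?ltr0n ?fact_gt0 // ler_pdivrMl ?ltr0n ?fact_gt0 //.
  by rewrite -natrX -natrM ler_nat fact_addn_le ?leq_add2r.
rewrite mulrA; apply: le_trans (_ : _ <= (size (col_seqs (M + k) n n))%:R * x ^+ n *
    ((n + k)%:R ^+ k / (M + k)`!%:R)) _; last first.
  by rewrite le_eqVlt; apply/orP; left; apply/eqP; ring.
by apply: ler_pM; rewrite ?mulr_ge0 ?exprn_ge0 ?invr_ge0 ?ler0n ?(ltW x0).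
Qed.

Lemma num_normalized_sqr_le m : (0 < m)%N -> exists2 C : R, 0 < C &
  forall n, h2 n ^+ 2 * (m%:R ^+ n) ^+ 2 * l ^+ n <=
            C * (m.+1%:R ^+ n) ^+ 2 * (h1 n * D n).
Proof.
(* A square root will turn [(2 * q) ^ 2] into [2 * q]; against the weight [q ^ t] this leaves the
   summable factor 2^-t. *)
move=> m0; set q := m.+1; have [C C0 HC] := dobinski_growth R ((2 * q) ^ 2)%N.
exists (4 * C); first by rewrite mulr_gt0.
move=> n; have l0 := ln2_gt0.
(* Up to a constant, the geometric mean of h'(n) and l^-n D(n). *)
pose S := Num.sqrt (C * (h1 n * D n) / l ^+ n).
have mono t : h1 (n - t) <= h1 n.
  rewrite ler_nat; elim: t => [|t IH]; first by rewrite subn0.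
  apply: leq_trans IH; rewrite subnS; case: (n - t)%N => // p.
  exact: size_enum_simple_normalizedS.
have h1S t : (t <= n)%N -> h1 (n - t) * (2 * q%:R) ^+ t <= S.
  move=> tn; have D0 : 0 <= D n := le_trans ler01 (dobinski_ge1 R n).
  rewrite -[leLHS]ger0_norm ?mulr_ge0 ?exprn_ge0 ?ler0n ?mulr_ge0 ?ler0n //.
  rewrite -sqrtr_sqr ler_wsqrtr // ler_pdivlMr ?exprn_gt0 //.
  have := HC (n - t)%N t; rewrite subnK // => HCt.
  have := num_simple_normalized_le (n - t) => Hs.
  have lnt : l ^+ n <= l ^+ (n - t) by rewrite ler_wiXn2l ?leq_subr // ?(ltW l0) // (ltW ln2_lt1).
  have q0 : 0 <= (2 * q%:R) ^+ t :> R by rewrite exprn_ge0 // mulr_ge0 ?ler0n.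
  have a0 : 0 <= h1 (n - t) by rewrite ler0n.
  rewrite exprMn -exprM mulnC exprM.
  have KE : ((2 * q) ^ 2)%N%:R = (2 * q%:R) ^+ 2 :> R by rewrite natrX natrM.
  rewrite KE in HCt.
  (* In the square of h'(n - t), one factor is bounded by h'(n) through monotonicity and the other
     by l^-n D(n - t), using l < 1. *)
  apply: (@le_trans _ _ (h1 n * (D (n - t) * ((2 * q%:R) ^+ 2) ^+ t))); last first.
    by rewrite [leRHS]mulrCA ler_wpM2l ?ler0n.
  have al : h1 (n - t) * l ^+ n <= D (n - t) by apply: (le_trans _ Hs); apply: ler_wpM2l.
  have -> : h1 (n - t) ^+ 2 * ((2 * q%:R) ^+ 2) ^+ t * l ^+ n =
    h1 (n - t) * (h1 (n - t) * l ^+ n * ((2 * q%:R) ^+ 2) ^+ t) by ring.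
  apply: ler_pM => //; last by rewrite ler_wpM2r ?exprn_ge0 ?sqr_ge0.
  by rewrite !mulr_ge0 ?exprn_ge0 ?sqr_ge0 ?ler0n ?(ltW l0).
have half : \sum_(t < n.+1) (2^-1 : R) ^+ t <= 2.
  have := @geometric_le_lim R n.+1 1 2^-1 ler01; rewrite gtr0_norm ?invr_gt0 ?ltr0n //.
  have -> : (1 : R) / (1 - 2^-1) = 2 by field.
  move=> /(_ isT); rewrite invf_lt1 ?ltr0n ?ltr1n // => /(_ isT).
  rewrite seriesEord /=; under eq_bigr do rewrite mul1r.
  by [].
have main : h2 n * m%:R ^+ n <= 2 * q%:R ^+ n * S.
  have := size_enum_normalized_le n (ltn0Sn m); rewrite -(ler_nat R) natrM natrX /= natr_sum.
  move=> /le_trans; apply.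
  apply: (@le_trans _ _ (\sum_(t < n.+1) (q%:R ^+ n * S) * 2^-1 ^+ t)); last first.
    rewrite -mulr_sumr (_ : 2 * q%:R ^+ n * S = q%:R ^+ n * S * 2); last by ring.
    by rewrite ler_wpM2l // mulr_ge0 ?sqrtr_ge0 ?exprn_ge0 ?ler0n.
  apply: ler_sum => t _; have tn : (t <= n)%N by rewrite -ltnS.
  rewrite natrM natrX exprVn ler_pdivlMr ?exprn_gt0 ?ltr0n //.
  rewrite exprD [leRHS]mulrC; apply: le_trans (ler_wpM2r _ (h1S t tn)); last first.
    by rewrite exprn_ge0 ?ler0n.
  by rewrite exprMn le_eqVlt; apply/orP; left; apply/eqP; rewrite /num_simple_normalized; ring.
have := main; rewrite -(@ler_pXn2r _ 2) ?nnegrE ?mulr_ge0 ?sqrtr_ge0 ?exprn_ge0 ?ler0n //.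
rewrite !exprMn sqr_sqrtr; last first.
  by rewrite divr_ge0 ?exprn_ge0 ?mulr_ge0 ?ler0n ?(ltW C0) ?(ltW l0) ?(le_trans ler01 (dobinski_ge1 R n)).
move=> H; rewrite -ler_pdivlMr ?exprn_gt0 //; apply: le_trans H _.
by rewrite le_eqVlt; apply/orP; left; apply/eqP; ring.
Qed.

End Counting.

(** * Limits of n-th roots from exponential bounds *)

Section RootLimit.
Variable R : realType.

Lemma exp_eventually_le (a b c : R) : 0 < a < b -> 0 < c ->
  \forall n \near \oo, a ^+ n <= c * b ^+ n.
Proof.
move=> /andP[a0 ab] c0; have b0 : 0 < b := lt_trans a0 ab.
have ab1 : `|a / b| < 1 by rewrite ger0_norm ?divr_ge0 ?(ltW a0) ?(ltW b0) // ltr_pdivrMr ?mul1r.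
have /cvgr_le /(_ c c0) := cvg_expr ab1.
by apply: filterS => n; rewrite expr_div_n ler_pdivrMr ?exprn_gt0.
Qed.

Lemma powR_inv_natK (a : R) n : (0 < n)%N -> 0 < a -> (a ^+ n) `^ n%:R^-1 = a.
Proof.
move=> n0 a0; rewrite -powR_mulrn ?(ltW a0) // -powRrM divff ?powRr1 ?(ltW a0) //.
by rewrite pnatr_eq0 -lt0n.
Qed.

(** Applying the bounds at rates halfway between [L] and the target rates lets the ratio of
    exponentials absorb the constants for large [n]. *)
Lemma cvg_root (L : R) (u : nat -> R) : 1 < L ->
  (forall r, 1 <= r < L -> exists2 c, 0 < c & forall n, (0 < n)%N -> c * r ^+ n <= u n) ->
  (forall r, L < r -> exists2 c, 0 < c & forall n, (0 < n)%N -> u n <= c * r ^+ n) ->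
  u n `^ n%:R^-1 @[n --> \oo] --> L.
Proof.
move=> L1 lo hi; apply/cvgrPdist_le => e e0.
(* The maximum with 1 keeps the rate in the range of [lo] even when [L - e] is small or negative. *)
pose r1 := Num.max 1 (L - e); pose r2 := L + e.
have r11 : 1 <= r1 by rewrite le_max lexx.
have r1L : r1 < L by rewrite gt_max L1 /= ltrBlDr ltrDl.
have r1e : L - e <= r1 by rewrite le_max lexx orbT.
have [c c0 Hc] : exists2 c, 0 < c & forall n, (0 < n)%N -> c * ((r1 + L) / 2) ^+ n <= u n.
  by apply: lo; lra.
have [C C0 HC] : exists2 c, 0 < c & forall n, (0 < n)%N -> u n <= c * ((L + r2) / 2) ^+ n.
  by apply: hi; rewrite /r2; lra.
have l1 := @exp_eventually_le r1 ((r1 + L) / 2) c _ c0.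
have l2 := @exp_eventually_le ((L + r2) / 2) r2 C^-1.
near=> n.
have n0 : (0 < n)%N by near: n; exact: nbhs_infty_gt.
have H1 : r1 ^+ n <= u n.
  by apply: le_trans (Hc n n0); near: n; apply: l1; lra.
have H2 : u n <= r2 ^+ n.
  apply: le_trans (HC n n0) _; rewrite -ler_pdivlMl //; near: n; apply: l2.
    by rewrite /r2; lra.
  by rewrite invr_gt0.
have ni0 : 0 <= n%:R^-1 :> R by rewrite invr_ge0 ler0n.
have u0 : 0 <= u n by apply: le_trans H1; rewrite exprn_ge0 //; lra.
have G1 : r1 <= u n `^ n%:R^-1.
  rewrite -[leLHS](@powR_inv_natK r1 n) //; last by lra.
  by rewrite ge0_ler_powR // nnegrE // exprn_ge0 //; lra.
have G2 : u n `^ n%:R^-1 <= r2.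
  rewrite -[leRHS](@powR_inv_natK r2 n) //; last by rewrite /r2; lra.
  by rewrite ge0_ler_powR // nnegrE // exprn_ge0 // /r2; lra.
by rewrite ler_norml; rewrite /r2 in G2; lra.
Unshelve. all: by end_near.
Qed.

End RootLimit.

(** * Exponential rates of both counts relative to the Bell numbers *)

Section Rates.
Variable R : realType.
Local Notation D := (@dobinski R).
Local Notation l := (ln (2 : R)).
Local Notation h1 n := ((num_simple_normalized n)%:R : R).
Local Notation h2 n := ((num_normalized n)%:R : R).

Lemma dobinski_gt0 n : 0 < D n. Proof. exact: lt_le_trans ltr01 (dobinski_ge1 R n). Qed.

Lemma bell_gt0 n : 0 < (bell n)%:R :> R.
Proof.
have := lt_le_trans (dobinski_gt0 n) (dobinski_le_bell R n).
by rewrite pmulr_rgt0 // expR_gt0.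
Qed.

Lemma num_simple_normalized_le_num_normalized n :
  (num_simple_normalized n <= num_normalized n)%N.
Proof.
apply: (leq_size_in_inj (f := id)); [exact: fset_uniq|by []|move=> H HN].
by apply/mem_enum_normalized; move/mem_enum_simple_normalized: HN => [].
Qed.

Lemma num_normalized_sqr_le_exp (w : R) : 1 < w -> exists2 C : R, 0 < C &
  forall n, h2 n ^+ 2 * l ^+ n <= C * (w ^+ n) ^+ 2 * (h1 n * D n).
Proof.
move=> w1; have [m m0 mw] : exists2 m, (0 < m)%N & m.+1%:R <= w * m%:R.
  (* Any [m] above [1 / (w - 1)] gives [(m + 1) / m <= w]. *)
  pose m := (Num.bound (w - 1)^-1).+1; exists m => //.
  have : 1 < m%:R * (w - 1).
    rewrite -ltr_pdivrMr ?subr_gt0 // div1r (lt_le_trans (archi_boundP _)) ?ler_nat ?leqnSn //.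
    by rewrite invr_ge0 subr_ge0 ltW.
  rewrite -[m.+1%:R]natr1; nra.
have [C C0 HC] := num_normalized_sqr_le R m0; exists C => // n.
have mn0 : 0 < (m%:R ^+ n) ^+ 2 :> R by rewrite !exprn_gt0 ?ltr0n.
rewrite -(ler_pM2r mn0) mulrAC; apply: le_trans (HC n) _.
rewrite [leRHS]mulrAC -[C * _ * _ in leRHS]mulrA -!exprMn.
have D0 := ltW (dobinski_gt0 n).
rewrite ler_wpM2r ?mulr_ge0 ?ler0n // ler_wpM2l ?(ltW C0) //.
have w0 : 0 < w := lt_trans ltr01 w1.
by rewrite !lerXn2r ?nnegrE ?exprn_ge0 ?mulr_ge0 ?ler0n ?(ltW w0).
Qed.

Lemma num_simple_normalized_lower (r : R) : 1 <= r < l^-1 ->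
  exists2 c : R, 0 < c & forall n, (0 < n)%N -> c * r ^+ n <= h1 n / (bell n)%:R.
Proof.
move=> /andP[r1 rl]; have l0 := ln2_gt0 R; have r0 : 0 < r := lt_le_trans ltr01 r1.
pose a := (r * l)^-1.
have a1 : 1 < a by rewrite invf_gt1 ?mulr_gt0 // -ltr_pdivlMr // div1r.
(* The slack [a] is split into six factors: the rate [l * w] in place of [l] and the polynomial
   factor cost one [w] each, doubled by squaring, and [num_normalized_sqr_le_exp] costs two more. *)
have [w w1 w6] : exists2 w, 1 < w & w ^+ 6 = a.
  exists (expR (ln a / 6%:R)); first by rewrite expR_gt1 divr_gt0 ?ln_gt0.
  by rewrite -expRM_natr mulfVK ?pnatr_eq0 // lnK // posrE (lt_trans ltr01).
have w0 : 0 < w := lt_trans ltr01 w1.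
(* The lower bound for h'' needs a rate at most 1; here [w <= a <= l^-1] because [r >= 1]. *)
have lw1 : l * w <= 1.
  rewrite mulrC -ler_pdivlMr // div1r; apply: (@le_trans _ _ a).
    by rewrite -w6 exprS ler_peMr ?exprn_ege1 // ltW.
  by rewrite lef_pV2 ?posrE ?mulr_gt0 // ler_peMl // ltW.
have lw0 : 0 < l * w by rewrite mulr_gt0.
have [k Hk] : exists k, 1 <= \sum_(d < k) (l * w) ^+ d.+1 / d.+1`!%:R.
  by apply: gt_ln2_sum_ge1; rewrite ltr_pMr.
have [P P0 HP] := polynomial_le_exponential k w1.
have [C C0 HC] := num_normalized_sqr_le_exp w1.
pose kap := (l * w) ^+ k / (expR 1 * P).
have kap0 : 0 < kap by rewrite divr_gt0 ?exprn_gt0 ?mulr_gt0 ?expR_gt0.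
exists (kap ^+ 2 / C); first by rewrite divr_gt0 ?exprn_gt0.
move=> n n0; have D0 := dobinski_gt0 n.
have low : kap * D n <= (l * w ^+ 2) ^+ n * h2 n.
  rewrite /kap mulrAC ler_pdivrMr ?mulr_gt0 ?expR_gt0 //.
  have := @num_normalized_ge R n k (l * w) n0; rewrite lw0 lw1 => /(_ isT Hk).
  move=> /le_trans; apply.
  have -> : (l * w ^+ 2) ^+ n * h2 n * (expR 1 * P) =
    expR 1 * (P * w ^+ n) * (l * w) ^+ n * h2 n by rewrite !exprMn; ring.
  rewrite ler_wpM2r ?ler0n // ler_wpM2r ?exprn_ge0 ?(ltW lw0) //.
  by rewrite ler_wpM2l ?expR_ge0.
have rn : r ^+ n * ((w ^+ 6) ^+ n * l ^+ n) = 1.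
  by rewrite -!exprMn w6 /a mulrCA mulVf ?expr1n // gt_eqF // mulr_gt0.
have h0 : 0 <= (l * w ^+ 2) ^+ n * h2 n.
  by rewrite mulr_ge0 ?exprn_ge0 ?mulr_ge0 ?exprn_ge0 ?ler0n ?(ltW l0) ?(ltW w0).
have sq : (kap * D n) ^+ 2 * l ^+ n <= ((l * w ^+ 2) ^+ n) ^+ 2 * (C * (w ^+ n) ^+ 2 * (h1 n * D n)).
  apply: (@le_trans _ _ (((l * w ^+ 2) ^+ n * h2 n) ^+ 2 * l ^+ n)).
    rewrite ler_wpM2r ?exprn_ge0 ?(ltW l0) // lerXn2r ?nnegrE //.
    by rewrite mulr_ge0 ?(ltW kap0) ?(ltW D0).
  rewrite exprMn -[leLHS]mulrA; apply: ler_wpM2l; last exact: HC.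
  exact: sqr_ge0.
have ln0 : 0 < l ^+ n by rewrite exprn_gt0.
have {}sq : kap ^+ 2 * D n <= C * h1 n * ((w ^+ 6) ^+ n * l ^+ n).
  rewrite -(ler_pM2r (mulr_gt0 D0 ln0)).
  have -> : kap ^+ 2 * D n * (D n * l ^+ n) = (kap * D n) ^+ 2 * l ^+ n by ring.
  apply: le_trans sq _; rewrite le_eqVlt; apply/orP; left; apply/eqP.
  have -> : (w ^+ 6) ^+ n = (w ^+ n) ^+ 6 by rewrite -!exprM mulnC.
  have -> : (l * w ^+ 2) ^+ n = l ^+ n * (w ^+ n) ^+ 2 by rewrite exprMn -!exprM mulnC.
  ring.
rewrite ler_pdivlMr ?bell_gt0 //.
apply: (@le_trans _ _ (kap ^+ 2 / C * r ^+ n * D n)).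
  rewrite ler_wpM2l ?bell_le_dobinski // mulr_ge0 ?divr_ge0 ?exprn_ge0 ?(ltW r0) ?(ltW C0) //.
  exact: ltW.
have -> : kap ^+ 2 / C * r ^+ n * D n = (kap ^+ 2 * D n) * (r ^+ n / C) by ring.
have -> : h1 n = C * h1 n * ((w ^+ 6) ^+ n * l ^+ n) * (r ^+ n / C).
  rewrite -[LHS]mulr1 -[X in _ * X = _]rn; move: (_ * l ^+ n) (r ^+ n) => X y.
  by field; exact: lt0r_neq0.
by rewrite ler_wpM2r // divr_ge0 ?exprn_ge0 ?(ltW r0) ?(ltW C0).
Qed.

(** Take [w = r * l] in the comparison of squares and bound h'(n) by l^-n D(n): all powers of [l]
    cancel and h''(n) is at most a constant times [r ^ n] D(n). *)
Lemma num_normalized_upper (r : R) : l^-1 < r ->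
  exists2 c : R, 0 < c & forall n, (0 < n)%N -> h2 n / (bell n)%:R <= c * r ^+ n.
Proof.
move=> rl; have l0 := ln2_gt0 R.
have w1 : 1 < r * l by rewrite -ltr_pdivrMr // div1r.
have r0 : 0 < r by rewrite (lt_trans _ rl) // invr_gt0.
have [C C0 HC] := num_normalized_sqr_le_exp w1.
exists (Num.sqrt C * expR 1); first by rewrite mulr_gt0 ?sqrtr_gt0 ?expR_gt0.
move=> n _; have D0 := dobinski_gt0 n; have ln0 : 0 < l ^+ n by rewrite exprn_gt0.
rewrite ler_pdivrMr ?bell_gt0 //.
apply: (@le_trans _ _ (Num.sqrt C * r ^+ n * D n)); last first.
  have -> : Num.sqrt C * expR 1 * r ^+ n * (bell n)%:R =
    Num.sqrt C * r ^+ n * (expR 1 * (bell n)%:R) by ring.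
  by rewrite ler_wpM2l ?dobinski_le_bell // mulr_ge0 ?sqrtr_ge0 ?exprn_ge0 ?(ltW r0).
rewrite -(@ler_pXn2r _ 2) ?nnegrE ?mulr_ge0 ?sqrtr_ge0 ?exprn_ge0 ?ler0n ?(ltW r0) ?(ltW D0) //.
rewrite !exprMn sqr_sqrtr ?(ltW C0) // -(ler_pM2r ln0); apply: le_trans (HC n) _.
rewrite exprMn exprMn.
have := num_simple_normalized_le R n => Hs.
have -> : C * ((r ^+ n) ^+ 2 * (l ^+ n) ^+ 2) * (h1 n * D n) =
  C * (r ^+ n) ^+ 2 * D n * l ^+ n * (h1 n * l ^+ n) by ring.
have -> : C * (r ^+ n) ^+ 2 * D n ^+ 2 * l ^+ n =
  C * (r ^+ n) ^+ 2 * D n * l ^+ n * D n by ring.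
by rewrite ler_wpM2l // !mulr_ge0 ?exprn_ge0 ?(ltW r0) ?(ltW C0) ?(ltW D0) ?(ltW l0).
Qed.

End Rates.

Theorem mainTheorem1 (R : realType) :
  [/\ root_asymptotic ((ln (2 : R))^-1) num_simple_normalized bell,
      root_asymptotic ((ln (2 : R))^-1) num_normalized bell
    & (144 * 10 ^+ 3 + 269) / 10 ^+ 5 <= (ln (2 : R))^-1
        < (144 * 10 ^+ 3 + 270) / 10 ^+ 5].
Proof.
have l0 := ln2_gt0 R; have L1 : 1 < (ln (2 : R))^-1 by rewrite invf_gt1 // ln2_lt1.
(* This carries the lower rate from h' to h'' and the upper rate from h'' to h'. *)
have le12 n : (num_simple_normalized n)%:R / (bell n)%:R <=
    (num_normalized n)%:R / (bell n)%:R :> R.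
  rewrite ler_wpM2r ?invr_ge0 ?ler0n // ler_nat.
  exact: num_simple_normalized_le_num_normalized.
split.
- apply: cvg_root => // r; first exact: num_simple_normalized_lower.
  move=> /num_normalized_upper[c c0 Hc]; exists c => // n n0.
  exact: le_trans (le12 n) (Hc n n0).
- apply: cvg_root => // r; last exact: num_normalized_upper.
  move=> /num_simple_normalized_lower[c c0 Hc]; exists c => // n n0.
  exact: le_trans (Hc n n0) (le12 n).
- have /andP[lo hi] := ln2_bounds R; apply/andP; split.
    by rewrite -[leRHS]div1r ler_pdivlMr //; nra.
  by rewrite -[ltLHS]div1r ltr_pdivrMr //; nra.
Qed.
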